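(* Let $(\mathfrak{g},\bullet)$ be a symmetric Leibniz algebra obtained from the Lie algebra $(\mathfrak{g},[\;,\;])$ by means of $\omega$, and let $\langle\;,\;\rangle$ be a metric on $\mathfrak{g}$. Denote by $Z(\mathfrak{g})$ the center of $(\mathfrak{g},[\;,\;])$. Then $\langle\;,\;\rangle$ is associative (for $\bullet$) if and only if $(\mathfrak{g},[\;,\;],\langle\;,\;\rangle)$ is a quadratic Lie algebra and there exist a 3-linear symmetric form $T:\mathfrak{g}\times\mathfrak{g}\times\mathfrak{g}\to\mathbb{R}$ and a totally isotropic vector subspace $I\subset Z(\mathfrak{g})$ such that $T(I^\perp,\cdot,\cdot)=0$ and $$\langle\omega(x,y),z\rangle=T(x,y,z),\qquad x,y,z\in\mathfrak{g}.$$
   Context: Algebras are real and finite dimensional. A metric is a nondegenerate symmetric bilinear form; $I^\perp$ is the orthogonal of $I$, and $I$ is totally isotropic if $I\subset I^\perp$. A symmetric Leibniz algebra is an algebra that is both left Leibniz ($u\bullet(v\bullet w)=(u\bullet v)\bullet w+v\bullet(u\bullet w)$) and right Leibniz ($(v\bullet w)\bullet u=(v\bullet u)\bullet w+v\bullet(w\bullet u)$). Every symmetric Leibniz product has the form $u\bullet v=[u,v]+\omega(u,v)$, where $[\;,\;]$ is a Lie bracket on $\mathfrak{g}$ and $\omega:\mathfrak{g}\times\mathfrak{g}\to Z(\mathfrak{g})$ is a symmetric bilinear map with values in the center of $(\mathfrak{g},[\;,\;])$ satisfying $\omega([x,y],z)=\omega(\omega(x,y),z)=0$ for all $x,y,z$;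 one says $(\mathfrak{g},\bullet)$ is obtained from $(\mathfrak{g},[\;,\;])$ by means of $\omega$. The metric is associative if $\langle u\bullet v,w\rangle=\langle u,v\bullet w\rangle$ for all $u,v,w$. A quadratic Lie algebra is a Lie algebra with a metric for which all $\mathrm{ad}_u$ are skew-symmetric. *)

(* Defs.v *)
From HB Require Import structures.
From mathcomp Require Import all_boot all_order all_algebra.
From mathcomp Require Import sesquilinear reals.
Set Implicit Arguments.
Unset Strict Implicit.
Unset Printing Implicit Defensive.
Import GRing.Theory.
Local Open Scope ring_scope.

Section Algebras.
Variables (R : realType) (g : vectType R).
Implicit Types (mul br om : {bilinear g -> g -> g}) (B : {symmetric g}).

Definition left_leibniz mul : Prop :=
  forall u v w, mul u (mul v w) = mul (mul u v) w + mul v (mul u w).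

Definition right_leibniz mul : Prop :=
  forall u v w, mul (mul v w) u = mul (mul v u) w + mul v (mul w u).

Definition symmetric_leibniz mul : Prop := left_leibniz mul /\ right_leibniz mul.

Definition is_lie_bracket br : Prop :=
  (forall x, br x x = 0) /\
  (forall x y z, br x (br y z) + br y (br z x) + br z (br x y) = 0).

Definition in_lie_center br (z : g) : Prop := forall x, br z x = 0.

Definition obtained_by_means_of mul br om : Prop :=
  [/\ is_lie_bracket br,
      forall x y, om x y = om y x,
      forall x y, in_lie_center br (om x y),
      forall x y z, om (br x y) z = 0 /\ om (om x y) z = 0 &
      forall u v, mul u v = br u v + om u v].

Definition associative_metric mul B : Prop :=
  forall u v w, B (mul u v) w = B u (mul v w).

Definition quadratic_lie br B : Prop :=
  [/\ is_lie_bracket br,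
      nondegenerate B &
      forall u v w, B (br u v) w = - B v (br u w)].

Definition totally_isotropic B (I : {vspace g}) : Prop :=
  (I <= orthov B I)%VS.

Definition trilinear (T : g -> g -> g -> R) : Prop :=
  [/\ forall y z, scalar (fun x => T x y z),
      forall x z, scalar (fun y => T x y z) &
      forall x y, scalar (fun z => T x y z)].

Definition symmetric3 (T : g -> g -> g -> R) : Prop :=
  forall x y z, [/\ T y x z = T x y z, T x z y = T x y z, T z y x = T x y z,
                    T y z x = T x y z & T z x y = T x y z].

End Algebras.

(* Main.v *)
Require Import Defs.
From mathcomp Require Import all_boot all_order all_algebra.
From mathcomp Require Import sesquilinear reals.
From mathcomp Require Import lra.
Local Open Scope ring_scope.
Import GRing.Theory.
Set Implicit Arguments.
Unset Strict Implicit.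
Unset Printing Implicit Defensive.

(** Since the metric is symmetric, it is associative for the product exactly
    when the trilinear form <uv, w> is invariant under cyclic permutations of
    u, v, w.  Cyclic invariance is inherited by the form <vu, w> of the opposite
    product, because a transposition conjugates a 3-cycle into its inverse.  So
    it passes to the half difference and the half sum of the two forms, which
    are <[u, v], w> and <om(u, v), w>.  A form skew (respectively symmetric) in
    its first two arguments and cyclically invariant is alternating
    (respectively totally symmetric): the first case says that every ad_u is
    skew, the second that T(x, y, z) = <om(x, y), z> is a symmetric 3-form.
    This is [associative_metricP].

    For the subspace I one takes the span of the values of om.  It is central
    because om is.  It is isotropic because total symmetry turns
    <om(x, y), om(z, t)> into <om(om(z, t), x), y>, which vanishes as
    om(om(.,.),.) = 0.  Finally T(x, y, z) = <om(y, z), x> vanishes for x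
    orthogonal to I.  Conversely, the symmetry of T and the skewness of every
    ad_u make both parts of <uv, w> cyclically invariant. *)

Section BilinearImage.
Variables (F : fieldType) (U V W : vectType F) (f : {bilinear U -> V -> W}).

Definition bilinear_image : {vspace W} :=
  <<[seq f x y | x <- vbasis {:U}, y <- vbasis {:V}]>>%VS.

Lemma mem_bilinear_image x y : f x y \in bilinear_image.
Proof.
rewrite (coord_vbasis (memvf x)) linear_sumlz memv_suml // => i _.
rewrite linearZl_LR memvZ // (coord_vbasis (memvf y)) linear_sumr.
rewrite memv_suml // => j _; rewrite linearZr_LR memvZ // memv_span //.
by apply: allpairs_f; rewrite mem_nth ?size_tuple.
Qed.

(** The values of a bilinear map need not form a subspace, so a property has to
    be propagated along linear combinations to reach the whole span. *)
Lemma bilinear_image_ind (P : W -> Prop) :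
    P 0 -> (forall a u v, P u -> P v -> P (a *: u + v)) ->
    (forall x y, P (f x y)) ->
  forall z, z \in bilinear_image -> P z.
Proof.
move=> P0 PZD Pf z zI; rewrite (coord_span (X := in_tuple _) zI) /=.
elim/big_rec: _ => // i s _ Ps; apply: PZD => //.
set X := [seq _ | _ <- _, _ <- _]; have : X`_i \in X by exact: mem_nth.
by case/allpairsP=> -[x y] [_ _ ->]; apply: Pf.
Qed.

End BilinearImage.

Section AssociativeMetric.
Variables (R : realType) (g : vectType R).
Variables (mul br om : {bilinear g -> g -> g}) (B : {symmetric g}).

Lemma symmetric_formC x y : B x y = B y x.
Proof. by rewrite hermC expr0 mul1r. Qed.

(* These three restate bilinearity for B itself rather than for its underlying
   bilinear map, so that the results rewrite with facts stated on B. *)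
Lemma symmetric_formDl x y z : B (x + y) z = B x z + B y z.
Proof. exact: linearDl. Qed.

Lemma symmetric_formDr x y z : B x (y + z) = B x y + B x z.
Proof. exact: linearDr. Qed.

Lemma symmetric_formNl x y : B (- x) y = - B x y.
Proof. exact: linearNl. Qed.

Lemma lie_bracketC (lie_br : is_lie_bracket br) x y : br y x = - br x y.
Proof.
have := lie_br.1 (x + y); rewrite linearDl !linearDr !lie_br.1 add0r addr0.
by move=> /(canRL (addKr _)); rewrite addr0.
Qed.

Hypothesis mul_obtained : obtained_by_means_of mul br om.

(** Reversing the order of the product changes the sign of the bracket and fixes
    om, so cyclic invariance of <uv, w> and of <vu, w> is that of the two parts
    separately; dividing by 2 is what separates them. *)
Lemma associative_metricP :
  associative_metric mul B <->
  (forall u v w, B (br u v) w = - B v (br u w)) /\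
  (forall x y z, B (om x y) z = B (om y z) x).
Proof.
case: mul_obtained => lie_br omC _ _ mulE.
split=> [assoc | [br_skew om_cyclic] u v w]; last first.
  rewrite !mulE symmetric_formDl symmetric_formDr om_cyclic [B (om v w) u]symmetric_formC.
  congr (_ + _).
  by rewrite (lie_bracketC lie_br v u) symmetric_formNl br_skew opprK.
have mul_cyclic u v w :
    B (br u v) w + B (om u v) w = B (br v w) u + B (om v w) u.
  by rewrite -!symmetric_formDl -!mulE assoc symmetric_formC.
have opp_cyclic u v w :
    - B (br u v) w + B (om u v) w = - B (br v w) u + B (om v w) u.
  (* Cyclic invariance for the opposite product is that of the product itself,
     read on the reversed triple. *)
  rewrite -!symmetric_formNl -!(lie_bracketC lie_br) (omC u v) (omC v w).
  by rewrite mul_cyclic mul_cyclic.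
split=> [u v w | x y z].
  have := mul_cyclic v w u; have := opp_cyclic v w u.
  have := mul_cyclic u v w; have := opp_cyclic u v w.
  rewrite (lie_bracketC lie_br w u) (symmetric_formC v) symmetric_formNl.
  by lra.
by have := mul_cyclic x y z; have := opp_cyclic x y z; lra.
Qed.

End AssociativeMetric.

Section CyclicForm.
Variables (R : realType) (g : vectType R).
Variables (om : {bilinear g -> g -> g}) (B : {symmetric g}).
Hypothesis omC : forall x y, om x y = om y x.
Hypothesis om_cyclic : forall x y z, B (om x y) z = B (om y z) x.

Lemma cyclic_form_trilinear : trilinear (fun x y z => B (om x y) z).
Proof.
split=> [y z a u v | x z a u v | x y a u v] /=.
- by rewrite linearPl linearDl linearZl_LR.
- by rewrite linearPr linearDl linearZl_LR.
- by rewrite linearPr.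
Qed.

Lemma cyclic_form_symmetric3 : symmetric3 (fun x y z => B (om x y) z).
Proof.
move=> x y z; split.
- by rewrite omC.
- by rewrite omC om_cyclic omC om_cyclic omC om_cyclic omC.
- by rewrite omC -om_cyclic.
- by rewrite -om_cyclic.
- by rewrite om_cyclic.
Qed.

(** On generators, <om(x, y), om(z, t)> is by cyclicity <om(om(z, t), x), y>. *)
Lemma bilinear_image_isotropic :
  (forall x y z, om (om x y) z = 0) -> totally_isotropic B (bilinear_image om).
Proof.
move=> om_nil; apply/orthovP => u v uI vI.
elim/bilinear_image_ind: u / uI => [|a u u' u0 u'0|x y].
- exact: linear0l.
- by rewrite linearPl /= u0 u'0 mulr0 addr0.
elim/bilinear_image_ind: v / vI => [|a v v' v0 v'0|z t].
- exact: linear0r.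
- by rewrite linearPr /= v0 v'0 mulr0 addr0.
by rewrite -om_cyclic om_nil linear0l.
Qed.

End CyclicForm.

Theorem theorem3p2 (R : realType) (g : vectType R)
    (mul br om : {bilinear g -> g -> g}) (B : {symmetric g})
    (mul_leibniz : symmetric_leibniz mul)
    (mul_obtained : obtained_by_means_of mul br om)
    (B_nondegenerate : nondegenerate B) :
  associative_metric mul B <->
  quadratic_lie br B /\
  exists (T : g -> g -> g -> R) (I : {vspace g}),
    [/\ trilinear T /\ symmetric3 T,
        totally_isotropic B I,
        forall z, z \in I -> in_lie_center br z,
        forall x y z, x \in orthov B I -> T x y z = 0 &
        forall x y z, B (om x y) z = T x y z].
Proof.
have [lie_br omC om_central om_nil _] := mul_obtained.
have assocP := associative_metricP B mul_obtained.
split=> [/assocP[br_skew om_cyclic] | [[_ _ br_skew] [T [I [[_ Tsym] _ _ _ TE]]]]].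
  split; first by split.
  exists (fun x y z => B (om x y) z), (bilinear_image om); split=> //.
  - split; first exact: cyclic_form_trilinear.
    exact: cyclic_form_symmetric3.
  - by apply: bilinear_image_isotropic => // x y z; have [] := om_nil x y z.
  - apply: bilinear_image_ind => // [y | a u v u_central v_central y].
      exact: linear0l.
    by rewrite linearPl u_central v_central scaler0 addr0.
  - move=> x y z /mem_orthovP xI.
    by rewrite om_cyclic symmetric_formC xI // mem_bilinear_image.
apply/assocP; split=> // x y z; rewrite !TE.
by have [_ _ _ -> _] := Tsym x y z.
Qed.
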